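(* Let $f:\mathbb{R}^n\to\mathbb{R}$ be smooth and strongly convex, let $C\in\mathbb{R}^{m\times n}$, $d\in\mathbb{R}^m$, $h(x)=Cx-d$, and let $\rho>0$, $K_i>0$, $K_p>0$. Assume that $C$ is full rank and that there exist constants $0<\underline{c}\le\overline{c}$ such that $$\underline{c}\, I\preceq CC^\top\preceq \overline{c}\, I,$$ and assume $\rho<\overline{c}^{-1}$. Consider the dynamical system $$\dot x=-\nabla f(x)-\nabla_x g(x,\lambda),\qquad \dot\lambda=K_i\nabla_\lambda g(x,\lambda)+K_p\, C\,\dot x,$$ with $g$ as defined in the context, and let $z^\star=(x^{\star\top},\lambda^{\star\top})^\top$ be its equilibrium point. Let $0<\underline{g}\le\overline{g}$ be constants such that $$\underline{g}\, I\preceq B(x)+\rho\, C^\top\Gamma(z)C\preceq\overline{g}\, I\qquad\text{for all } z=(x^\top,\lambda^\top)^\top\in\mathbb{R}^{n+m},$$ with $B(x)$ and $\Gamma(z)$ as defined in the context. Let $\mu\in\mathbb{R}$ satisfy $$\mu\le\min\left\{\tfrac12 K_p\,\underline{c},\ \frac{2K_i\,\underline{g}-K_p\,\overline{g}^2}{K_i}\right\}.$$ Then for every solution $(x(t),\lambda(t))$, $t\ge 0$, of the system there exist real positive constants $\alpha_1,\alpha_2$ such that, for all $t\ge0$, $$\|x(t)-x^\star\|_2\le\alpha_1 e^{-\frac12\mu t},\qquad \|\lambda(t)-\lambda^\star\|_2\le\alpha_2 e^{-\frac12\mu t}.$$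
   Context: The problem to be solved is $\min_{x\in\mathbb{R}^n} f(x)$ subject to $h(x)=Cx-d\le 0$ (componentwise). The function $g:\mathbb{R}^n\times\mathbb{R}^m\to\mathbb{R}$ is $g(x,\lambda)=\sum_{j=1}^m g_j(x,\lambda_j)$, where $$g_j(x,\lambda_j)=\begin{cases}\lambda_j h_j(x)+\frac{\rho}{2}h_j(x)^2 & \text{if } h_j(x)\ge-\lambda_j/\rho,\\ -\frac{1}{2\rho}\lambda_j^2&\text{otherwise.}\end{cases}$$ It is continuously differentiable, with $$\nabla_x g_j(x,\lambda_j)=\max\{\rho h_j(x)+\lambda_j,0\}\,C_j^\top,\qquad \frac{\partial g_j}{\partial\lambda_j}(x,\lambda_j)=\frac{\max\{\rho h_j(x)+\lambda_j,0\}-\lambda_j}{\rho},$$ where $C_j$ is the $j$-th row of $C$. The augmented Lagrangian is $\mathcal{L}(x,\lambda)=f(x)+g(x,\lambda)$. An equilibrium point $(x^\star,\lambda^\star)$ of the system is a point at which the right-hand sides vanish ($\dot x=0$, $\dot\lambda=0$); it corresponds to a saddle point of $\mathcal{L}$. $B(x)\in\mathbb{R}^{n\times n}$ denotes a symmetric positive definite matrix (which exists by strong convexity of $f$) with $\nabla f(x)-\nabla f(x^\star)=B(x)(x-x^\star)$. $\Gamma(z)=\mathrm{diag}(\gamma_1(z),\dots,\gamma_m(z))$ is a diagonal matrix with entries $\gamma_j(z)\in[0,1]$ such that, for each $j$, $$\max\{\rho h_j(x)+\lambda_j,0\}-\max\{\rho h_j(x^\star)+\lambda^\star_j,0\}=\gamma_j(z)\big(\rho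 (h_j(x)-h_j(x^\star))+\lambda_j-\lambda_j^\star\big).$$ Here $A\preceq B$ for symmetric matrices means that $B-A$ is positive semidefinite. *)

(* Defs.v *)
From mathcomp Require Import all_boot all_order all_algebra.
From mathcomp Require Import all_classical all_reals all_analysis.

Set Implicit Arguments.
Unset Strict Implicit.
Unset Printing Implicit Defensive.

Import Order.TTheory GRing.Theory Num.Theory.
Import numFieldNormedType.Exports.

Local Open Scope classical_set_scope.
Local Open Scope ring_scope.

(* The canonical norm of 'cV[R]_n in the library is the max norm; it induces
   the same topology and derivatives as the Euclidean norm below. *)
Definition norm2 (R : realType) (n : nat) (v : 'cV[R]_n) : R :=
  Num.sqrt (\sum_(i < n) v i 0 ^+ 2).

Definition grad (R : realType) (n : nat) (f : 'cV[R]_n -> R) (x : 'cV[R]_n) :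
    'cV[R]_n :=
  \col_(i < n) 'D_(delta_mx i 0) f x.

Definition quadform (R : realType) (n : nat) (A : 'M[R]_n) (v : 'cV[R]_n) : R :=
  (v^T *m A *m v) 0 0.

Definition possemidef (R : realType) (n : nat) (A : 'M[R]_n) : Prop :=
  A^T = A /\ forall v : 'cV[R]_n, 0 <= quadform A v.

Definition posdef (R : realType) (n : nat) (A : 'M[R]_n) : Prop :=
  A^T = A /\ forall v : 'cV[R]_n, v != 0 -> 0 < quadform A v.

Definition loewner_le (R : realType) (n : nat) (A B : 'M[R]_n) : Prop :=
  possemidef (B - A).

Definition full_rank (R : realType) (m n : nat) (C : 'M[R]_(m, n)) : Prop :=
  \rank C = minn m n.

(* "Smooth" is read as C^1, the weakest of its usual meanings. *)
Definition smooth (R : realType) (n : nat) (f : 'cV[R]_n -> R) : Prop :=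
  (forall x, differentiable f x) /\ continuous (grad f).

Definition strongly_convex (R : realType) (n : nat) (f : 'cV[R]_n -> R) : Prop :=
  exists2 c : R, 0 < c &
    forall (x y : 'cV[R]_n) (t : R), 0 <= t -> t <= 1 ->
      f (t *: x + (1 - t) *: y) <=
        t * f x + (1 - t) * f y - c / 2 * t * (1 - t) * norm2 (x - y) ^+ 2.

Definition hfun (R : realType) (m n : nat) (C : 'M[R]_(m, n)) (d : 'cV[R]_m)
    (x : 'cV[R]_n) : 'cV[R]_m :=
  C *m x - d.

Definition gj (R : realType) (m n : nat) (C : 'M[R]_(m, n)) (d : 'cV[R]_m)
    (rho : R) (j : 'I_m) (x : 'cV[R]_n) (l : R) : R :=
  let hj := hfun C d x j 0 in
  if - l / rho <= hj then l * hj + rho / 2 * hj ^+ 2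
  else - (1 / (2 * rho)) * l ^+ 2.

Definition gfun (R : realType) (m n : nat) (C : 'M[R]_(m, n)) (d : 'cV[R]_m)
    (rho : R) (x : 'cV[R]_n) (lam : 'cV[R]_m) : R :=
  \sum_(j < m) gj C d rho j x (lam j 0).

Definition xrhs (R : realType) (m n : nat) (f : 'cV[R]_n -> R)
    (C : 'M[R]_(m, n)) (d : 'cV[R]_m) (rho : R)
    (x : 'cV[R]_n) (lam : 'cV[R]_m) : 'cV[R]_n :=
  - grad f x - grad (fun y => gfun C d rho y lam) x.

(* The last argument is the velocity of x, which enters the equation for the
   multipliers. *)
Definition lamrhs (R : realType) (m n : nat) (C : 'M[R]_(m, n)) (d : 'cV[R]_m)
    (rho Ki Kp : R) (x : 'cV[R]_n) (lam : 'cV[R]_m) (xdot : 'cV[R]_n) :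
    'cV[R]_m :=
  Ki *: grad (fun l => gfun C d rho x l) lam + Kp *: (C *m xdot).

Definition is_equilibrium (R : realType) (m n : nat) (f : 'cV[R]_n -> R)
    (C : 'M[R]_(m, n)) (d : 'cV[R]_m) (rho Ki Kp : R)
    (x : 'cV[R]_n) (lam : 'cV[R]_m) : Prop :=
  xrhs f C d rho x lam = 0 /\
  lamrhs C d rho Ki Kp x lam (xrhs f C d rho x lam) = 0.

(* Classical solution on [0, +oo[. At t = 0 only one-sided continuity is asked:
   the values of x and lam at negative times are irrelevant, and the one-sided
   equation at 0 follows by continuity of the right-hand sides. *)
Definition is_solution (R : realType) (m n : nat) (f : 'cV[R]_n -> R)
    (C : 'M[R]_(m, n)) (d : 'cV[R]_m) (rho Ki Kp : R)
    (x : R -> 'cV[R]_n) (lam : R -> 'cV[R]_m) : Prop :=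
  [/\ {within `[0, +oo[, continuous x},
      {within `[0, +oo[, continuous lam} &
      forall t : R, 0 < t ->
        [/\ derivable x t 1, derivable lam t 1,
            derive1 x t = xrhs f C d rho (x t) (lam t) &
            derive1 lam t = lamrhs C d rho Ki Kp (x t) (lam t) (derive1 x t)]].

Definition is_secant_matrix (R : realType) (n : nat) (f : 'cV[R]_n -> R)
    (xs : 'cV[R]_n) (B : 'cV[R]_n -> 'M[R]_n) : Prop :=
  forall x, posdef (B x) /\ grad f x - grad f xs = B x *m (x - xs).

Definition updated_multiplier (R : realType) (m n : nat) (C : 'M[R]_(m, n)) (d : 'cV[R]_m)
    (rho : R) (x : 'cV[R]_n) (lam : 'cV[R]_m) (j : 'I_m) : R :=
  Num.max (rho * hfun C d x j 0 + lam j 0) 0.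

(* gamma x lam is the diagonal of the matrix Gamma(z), z = (x, lam). *)
Definition is_secant_gamma (R : realType) (m n : nat) (C : 'M[R]_(m, n))
    (d : 'cV[R]_m) (rho : R) (xs : 'cV[R]_n) (lams : 'cV[R]_m)
    (gamma : 'cV[R]_n -> 'cV[R]_m -> 'rV[R]_m) : Prop :=
  forall x lam j,
    0 <= gamma x lam 0 j <= 1 /\
    updated_multiplier C d rho x lam j - updated_multiplier C d rho xs lams j =
      gamma x lam 0 j *
        (rho * (hfun C d x j 0 - hfun C d xs j 0) + lam j 0 - lams j 0).

(* Main.v *)
Require Import Defs.
From mathcomp Require Import all_boot all_order all_algebra.
From mathcomp Require Import all_classical all_reals all_analysis.
From mathcomp Require Import ring lra.

Import Order.TTheory GRing.Theory Num.Theory.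
Import numFieldNormedType.Exports.

Local Open Scope classical_set_scope.
Local Open Scope ring_scope.

(** Write [X], [L] for the errors of [x] and [lam], and [U] for the error of the
    updated multiplier max(rho h + lam, 0).  The equilibrium satisfies
    lams = max(rho h(xs) + lams, 0), so that in error coordinates
    X' = - (grad f x - grad f xs) - C^T U  and  L' = (Ki / rho) (U - L) + Kp C X'.
    The sign of [mu] separates two arguments.

    If [mu] is nonnegative, the Lyapunov function V = Ki |X|^2 + |L|^2 decays
    at rate [mu] ([sector_dissipation], [rate_decay]).  With U = Gamma (rho C X + L)
    and G = B + rho C^T Gamma C one has X' = - G X - C^T Gamma L; the
    terms coupling [X] and [L] through [Ki] cancel, and completing squares leaves
    the two quantities in the minimum that bounds [mu], provided that
    rho Kp C C^T <= Ki I.  This last bound holds because the bounds on [G] are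
    uniform in the multiplier: a large positive multiplier saturates Gamma near
    the identity, a large negative one near 0, so rho |C v|^2 is at most
    2 (g_hi - g_lo) |v|^2 ([multiplier_gain]); and a nonnegative [mu] forces
    Kp g_hi^2 <= 2 Ki g_lo, whereas 4 g_lo (g_hi - g_lo) <= g_hi^2.

    If [mu] is negative, the asserted bound grows with [t] and it is enough that
    the errors stay bounded ([error_bounded]).  No relation between [Ki]
    and [Kp] is available then, and the quadratic V above need not decrease.
    Boundedness comes from a Lur'e function: a quadratic form in [X] and in the
    integrator state L - Kp C X, plus multiples of the Bregman distances of [f]
    and of the convex potential max(s, 0)^2 / 2 of the updated multiplier
    ([lure_dissipation]).  Strong convexity of [f] enters through its first order
    consequence [strongly_convex_tangent]. *)

(** * Euclidean inner product *)

Definition dot {R : realType} {n : nat} (u v : 'cV[R]_n) : R :=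
  \sum_(i < n) u i 0 * v i 0.

Lemma dotC {R : realType} {n : nat} (u v : 'cV[R]_n) : dot u v = dot v u.
Proof. by apply: eq_bigr => i _; rewrite mulrC. Qed.

Lemma dotDl {R : realType} {n : nat} (u v w : 'cV[R]_n) :
  dot (u + v) w = dot u w + dot v w.
Proof. by rewrite -big_split; apply: eq_bigr => i _; rewrite mxE mulrDl. Qed.

Lemma dotZl {R : realType} {n : nat} a (u w : 'cV[R]_n) :
  dot (a *: u) w = a * dot u w.
Proof. by rewrite mulr_sumr; apply: eq_bigr => i _; rewrite mxE mulrA. Qed.

Lemma dotNl {R : realType} {n : nat} (u w : 'cV[R]_n) : dot (- u) w = - dot u w.
Proof. by rewrite -scaleN1r dotZl mulN1r. Qed.

Lemma dotDr {R : realType} {n : nat} (u v w : 'cV[R]_n) :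
  dot w (u + v) = dot w u + dot w v.
Proof. by rewrite dotC dotDl !(dotC w). Qed.

Lemma dotZr {R : realType} {n : nat} a (u w : 'cV[R]_n) :
  dot w (a *: u) = a * dot w u.
Proof. by rewrite dotC dotZl dotC. Qed.

Lemma dotNr {R : realType} {n : nat} (u w : 'cV[R]_n) : dot w (- u) = - dot w u.
Proof. by rewrite dotC dotNl dotC. Qed.

Definition dotE := (@dotDl, @dotDr, @dotNl, @dotNr, @dotZl, @dotZr).

Lemma dot_ge0 {R : realType} {n : nat} (u : 'cV[R]_n) : 0 <= dot u u.
Proof. by apply: sumr_ge0 => i _; rewrite -expr2 sqr_ge0. Qed.

Lemma dot_trmx {R : realType} {m n : nat} (A : 'M[R]_(m, n)) u v :
  dot u (A *m v) = dot (A^T *m u) v.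
Proof.
have dotM (k : nat) (a b : 'cV[R]_k) : dot a b = (a^T *m b) 0 0.
  by rewrite mxE; apply: eq_bigr => i _; rewrite mxE.
by rewrite !dotM trmx_mul trmxK mulmxA.
Qed.

Lemma quadform_dot {R : realType} {n : nat} (A : 'M[R]_n) v :
  quadform A v = dot v (A *m v).
Proof.
rewrite /quadform -mulmxA mxE; apply: eq_bigr => i _.
by rewrite mxE.
Qed.

Lemma sqr_norm2 {R : realType} {n : nat} (v : 'cV[R]_n) :
  norm2 v ^+ 2 = dot v v.
Proof.
rewrite sqr_sqrtr; first by apply: eq_bigr => i _; rewrite expr2.
by apply: sumr_ge0 => i _; exact: sqr_ge0.
Qed.

Lemma loewner_scalar_le {R : realType} {n : nat} a (A : 'M[R]_n) v :
  loewner_le a%:M A -> a * dot v v <= dot v (A *m v).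
Proof.
move=> [_ /(_ v)]; rewrite quadform_dot mulmxBl mul_scalar_mx !dotE.
by rewrite subr_ge0.
Qed.

Lemma loewner_le_scalar {R : realType} {n : nat} a (A : 'M[R]_n) v :
  loewner_le A a%:M -> dot v (A *m v) <= a * dot v v.
Proof.
move=> [_ /(_ v)]; rewrite quadform_dot mulmxBl mul_scalar_mx !dotE.
by rewrite subr_ge0.
Qed.

Lemma young2 {R : realType} {n : nat} (u v : 'cV[R]_n) a :
  2 * a * dot u v <= a ^+ 2 * dot u u + dot v v.
Proof.
have := dot_ge0 (a *: u - v); rewrite !dotE (dotC v u); nra.
Qed.

(** For a symmetric nonnegative form, a bound of the form bounds the operator:
    test nonnegativity on [g *: v - A *m v] and the upper bound on [v] and
    on [A *m v]. *)
Lemma sqr_mulmx_le {R : realType} {n : nat} (A : 'M[R]_n) g v :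
    A^T = A -> 0 < g -> (forall w, 0 <= dot w (A *m w)) ->
    (forall w, dot w (A *m w) <= g * dot w w) ->
  dot (A *m v) (A *m v) <= g ^+ 2 * dot v v.
Proof.
move=> At g0 A0 Ag.
have := A0 (g *: v - A *m v).
have e : dot v (A *m (A *m v)) = dot (A *m v) (A *m v) by rewrite dot_trmx At.
rewrite mulmxBr -scalemxAr !dotE e.
have := Ag v; have := Ag (A *m v).
move: (dot (A *m v) (A *m (A *m v))) (dot v (A *m v)) => a b h1 h2 h3.
have h4 : g * dot (A *m v) (A *m v) <= g * (g * b) by nra.
rewrite ler_pM2l// in h4; nra.
Qed.

(** A matrix and its transpose have the same operator norm.  Expanding
    |K p - A A^T p|^2 >= 0 proves it without spectral theory. *)
Lemma sqr_trmx_le {R : realType} {m n : nat} (A : 'M[R]_(m, n)) K :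
    0 < K -> (forall v, dot (A *m v) (A *m v) <= K * dot v v) ->
  forall p, dot (A^T *m p) (A^T *m p) <= K * dot p p.
Proof.
move=> K0 AK p.
have := AK (A^T *m p); have := dot_ge0 (K *: p - A *m (A^T *m p)).
rewrite !dotE (dotC _ p) !(dot_trmx A p) => h1 h2.
by rewrite -(ler_pM2l K0); nra.
Qed.

(** * Derivatives *)

Lemma is_derive_mx {R : realType} {V : normedModType R} {m n : nat}
    (M : V -> 'M[R]_(m, n)) (dM : 'M[R]_(m, n)) t v :
  is_derive t v M dM <->
  forall i j, is_derive t v (fun s => M s i j) (dM i j).
Proof.
split=> [[dvM eM] i j|H].
  split; last by rewrite -eM derive_mx// mxE.
  exact: (derivable_mxP M t v).1.
have dvM : derivable M t v by apply/derivable_mxP => i j; case: (H i j).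
by split=> //; rewrite derive_mx//; apply/matrixP => i j; rewrite mxE derive_val.
Qed.

Lemma is_derive_big {R : realType} {V W : normedModType R} {n : nat}
    (F : 'I_n -> V -> W) (dF : 'I_n -> W) t v :
  (forall i, is_derive t v (F i) (dF i)) ->
  is_derive t v (fun s => \sum_(i < n) F i s) (\sum_(i < n) dF i).
Proof.
move=> H; rewrite (_ : (fun s => _) = \sum_(i < n) F i); first exact: is_derive_sum.
by apply/funext => s; rewrite fct_sumE.
Qed.

Lemma is_derive_dot {R : realType} {n : nat} (u v : R -> 'cV[R]_n) (du dv : 'cV[R]_n) (t : R) :
  is_derive t 1 u du -> is_derive t 1 v dv ->
  is_derive t 1 (fun s => dot (u s) (v s)) (dot du (v t) + dot (u t) dv).
Proof.
move=> /is_derive_mx hu /is_derive_mx hv; rewrite -big_split /=.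
apply: is_derive_big => i.
apply: (is_derive_eq (is_deriveM (hu i 0) (hv i 0))).
rewrite /GRing.scale /=; ring.
Qed.

Lemma is_derive_mulmx {R : realType} {m n : nat} (A : 'M[R]_(m, n))
    (u : R -> 'cV[R]_n) (du : 'cV[R]_n) (t : R) :
  is_derive t 1 u du -> is_derive t 1 (fun s => A *m u s) (A *m du).
Proof.
move=> /is_derive_mx hu; apply/is_derive_mx => i j.
rewrite mxE (_ : (fun s => _) = fun s => \sum_k A i k * u s k j); last first.
  by apply/funext => s; rewrite mxE.
by apply: is_derive_big => k.
Qed.

(** Reduces directional derivatives to derivatives on the real line, where the
    chain rule applies to the scalar pieces of the augmented Lagrangian. *)
Lemma is_derive_line {R : realType} {V : normedModType R} (F : V -> R) x v (df : R) :
  is_derive (0 : R) 1 (fun h : R => F (h *: v + x)) df -> is_derive x v F df.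
Proof.
have e : (fun h : R => h^-1 *: (((fun h : R => F (h *: v + x)) \o shift 0)
    (h *: 1) - F (0 *: v + x))) =
    (fun h : R => h^-1 *: ((F \o shift x) (h *: v) - F x)).
  apply/funext => h /=.
  by rewrite addr0 scale0r add0r [_%:A]mulr1.
by move=> [d1 d2]; split; [move: d1; rewrite /derivable e|
  move: d2; rewrite /derive e].
Qed.

Lemma col_basis {R : realType} {n : nat} (v : 'cV[R]_n) :
  v = \sum_(i < n) v i 0 *: delta_mx i 0.
Proof.
apply/matrixP => i j; rewrite (ord1 j) summxE (bigD1 i)//= big1 ?addr0.
  by rewrite !mxE !eqxx mulr1.
by move=> k ki; rewrite !mxE eq_sym (negbTE ki) mulr0.
Qed.

Lemma derive_grad {R : realType} {n : nat} (f : 'cV[R]_n -> R) x v :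
  differentiable f x -> 'D_v f x = dot (grad f x) v.
Proof.
move=> df; rewrite deriveE// {1}(col_basis v) linear_sum; apply: eq_bigr => i _.
by rewrite linearZ mxE deriveE// mulrC.
Qed.

Lemma is_derive_comp_grad {R : realType} {n : nat} (f : 'cV[R]_n -> R)
    (x : R -> 'cV[R]_n) (dx : 'cV[R]_n) (t : R) :
  differentiable f (x t) -> is_derive t 1 x dx ->
  is_derive t 1 (f \o x) (dot (grad f (x t)) dx).
Proof.
move=> df [/derivable1_diffP dfx ex].
have dfo : differentiable (f \o x) t by exact: differentiable_comp.
split; first exact/derivable1_diffP.
by rewrite -derive_grad// -ex !deriveE// diff_comp.
Qed.

(** ** The positive part *)

Definition pospart {R : realType} (s : R) : R := Num.max s 0.

Lemma pospart_ge0 {R : realType} (s : R) : 0 <= pospart s.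
Proof. by rewrite le_max lexx orbT. Qed.

Lemma pospart_gap {R : realType} (s : R) : 0 <= pospart s - s.
Proof. by rewrite subr_ge0 le_max lexx. Qed.

Lemma pospart_compl {R : realType} (s : R) : pospart s * (pospart s - s) = 0.
Proof. by rewrite /pospart; case: (leP s 0) => _; rewrite ?mul0r// subrr mulr0. Qed.

(** The kink of the positive part disappears after squaring: the first order
    Taylor remainder at increment [h] lies between [0] and [h ^+ 2], whatever the
    signs of [s] and [h + s]. *)
Lemma is_derive_sqr_pospart {R : realType} (s : R) :
  is_derive s 1 (fun r => pospart r ^+ 2) (2 * pospart s).
Proof.
suff H : h^-1 *: (((fun r => pospart r ^+ 2) \o shift s) (h *: (1 : R)) -
    pospart s ^+ 2) @[h --> 0^'] --> 2 * pospart s.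
  by split; [apply/cvg_ex; exists (2 * pospart s)|exact: cvg_lim H].
apply/cvgrPdist_le => /= e e0; near=> h.
have h0 : h != 0 by near: h; exact: nbhs_dnbhs_neq.
have hh : `|h| <= e.
  by near: h; exact: dnbhs0_le.
apply: le_trans hh.
rewrite [_%:A]mulr1 /GRing.scale /= (_ : _ - _ =
  h^-1 * (2 * pospart s * h - (pospart (h + s) ^+ 2 - pospart s ^+ 2))); last first.
  by field.
rewrite normrM normfV ler_pdivrMl ?normr_gt0// -normrM -expr2.
have hp : 0 <= h ^+ 2 by exact: sqr_ge0.
rewrite (ger0_norm hp).
have := pospart_compl s; have := pospart_compl (h + s).
have := mulr_ge0 (pospart_ge0 s) (pospart_gap (h + s)).
have := mulr_ge0 (pospart_ge0 (h + s)) (pospart_gap s).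
move: (pospart s) (pospart (h + s)) => p q c1 c2 cq cp.
have lo : p ^+ 2 + 2 * p * h <= q ^+ 2.
  have := sqr_ge0 (q - p); nra.
have hi : q ^+ 2 <= p ^+ 2 + 2 * p * h + h ^+ 2.
  have := sqr_ge0 (p - s - (q - (h + s))); nra.
rewrite ler_norml; apply/andP; split; lra.
Unshelve. all: by end_near. Qed.

(** Firm nonexpansiveness of the projection onto the half line. *)
Lemma pospart_firm {R : realType} (s r : R) :
  0 <= (pospart s - pospart r) * ((s - r) - (pospart s - pospart r)).
Proof.
have := pospart_compl s; have := pospart_compl r.
have := mulr_ge0 (pospart_ge0 s) (pospart_gap r).
have := mulr_ge0 (pospart_ge0 r) (pospart_gap s).
nra.
Qed.

(** * Gradients of the augmented Lagrangian *)

Definition multiplier_col {R : realType} {m n : nat} (C : 'M[R]_(m, n))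
    (d : 'cV[R]_m) (rho : R) (x : 'cV[R]_n) (lam : 'cV[R]_m) : 'cV[R]_m :=
  \col_j updated_multiplier C d rho x lam j.

(** Completing the square merges the two branches of the augmented term, which
    shows that it is continuously differentiable. *)
Lemma gj_pospart {R : realType} {m n : nat} (C : 'M[R]_(m, n)) d rho j x l :
  0 < rho ->
  gj C d rho j x l =
  (2 * rho)^-1 * (pospart (rho * hfun C d x j 0 + l) ^+ 2 - l ^+ 2).
Proof.
move=> rho0; rewrite /gj; move: (hfun C d x j 0) => h.
have rhoN0 : rho != 0 by rewrite gt_eqF.
rewrite ler_pdivrMr// /pospart mulrC.
have [hl|hl] := leP (- l) (rho * h).
  have -> : Num.max (rho * h + l) 0 = rho * h + l by apply/max_idPl; lra.
  by field.
have -> : Num.max (rho * h + l) 0 = 0 by apply/max_idPr; lra.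
by field.
Qed.

Lemma is_derive_sqr_pospart_affine {R : realType} (a b : R) :
  is_derive (0 : R) 1 (fun h => pospart (a * h + b) ^+ 2) (2 * pospart b * a).
Proof.
have dl : is_derive (0 : R) 1 (fun h => a * h + b) a.
  apply: is_derive_eq; rewrite addr0 /GRing.scale /=; ring.
have := @is_derive1_comp _ (fun r => pospart r ^+ 2) (fun h => a * h + b) 0
  (2 * pospart (a * 0 + b)) a (is_derive_sqr_pospart _) dl.
by rewrite mulr0 add0r.
Qed.

Lemma grad_gfun_x {R : realType} {m n : nat} (C : 'M[R]_(m, n)) d rho x lam :
  0 < rho ->
  grad (fun y => gfun C d rho y lam) x = C^T *m multiplier_col C d rho x lam.
Proof.
move=> rho0; apply/matrixP => i j; rewrite (ord1 j) {j} !mxE.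
rewrite -[RHS](_ : \sum_j updated_multiplier C d rho x lam j * C j i = _); last first.
  by apply: eq_bigr => j _; rewrite !mxE mulrC.
apply: derive_val; apply: is_derive_big => j; apply: is_derive_line.
rewrite (_ : (fun h : R => _) = fun h : R => (2 * rho)^-1 *
  (pospart (rho * C j i * h + (rho * hfun C d x j 0 + lam j 0)) ^+ 2 -
   lam j 0 ^+ 2)); last first.
  apply/funext => h; rewrite gj_pospart//; congr (_ * (pospart _ ^+ 2 - _)).
  rewrite /hfun mulmxDr -scalemxAr -colE !mxE; ring.
have D := is_derive_sqr_pospart_affine (rho * C j i)
  (rho * hfun C d x j 0 + lam j 0).
apply: is_derive_eq.
rewrite subr0 /GRing.scale /= /updated_multiplier -/(pospart _).
by field; rewrite gt_eqF.
Qed.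

Lemma grad_gfun_lam {R : realType} {m n : nat} (C : 'M[R]_(m, n)) d rho x lam :
  0 < rho ->
  grad (fun l => gfun C d rho x l) lam =
  rho^-1 *: (multiplier_col C d rho x lam - lam).
Proof.
move=> rho0; apply/matrixP => i j; rewrite (ord1 j) {j} !mxE.
rewrite -[RHS](_ : \sum_j rho^-1 * (updated_multiplier C d rho x lam j - lam j 0) *
   (j == i)%:R = _); last first.
  rewrite (bigD1 i)//= eqxx mulr1 big1 ?addr0// => j /negbTE ->.
  by rewrite mulr0.
apply: derive_val; apply: is_derive_big => j; apply: is_derive_line.
rewrite (_ : (fun h : R => _) = fun h : R => (2 * rho)^-1 *
  (pospart ((j == i)%:R * h + (rho * hfun C d x j 0 + lam j 0)) ^+ 2 -
   ((j == i)%:R * h + lam j 0) ^+ 2)); last first.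
  apply/funext => h; rewrite gj_pospart// !mxE eqxx andbT.
  congr (_ * (pospart _ ^+ 2 - _ ^+ 2)); ring.
have D := is_derive_sqr_pospart_affine (j == i)%:R
  (rho * hfun C d x j 0 + lam j 0).
have D' : is_derive (0 : R) 1 (fun h : R => ((j == i)%:R * h + lam j 0) ^+ 2)
    (2 * lam j 0 * (j == i)%:R).
  apply: is_derive_eq; rewrite /GRing.scale /= mulr0 addr0 add0r; ring.
apply: is_derive_eq.
rewrite /GRing.scale /= /updated_multiplier -/(pospart _).
by field; rewrite gt_eqF.
Qed.

(** * Strong convexity to first order *)

(** Divide the convexity inequality on the segment by its parameter [t] and let
    [t] tend to [0]. *)
Lemma strongly_convex_tangent {R : realType} {n : nat} (f : 'cV[R]_n -> R) c :
    (forall x, differentiable f x) ->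
    (forall (x y : 'cV[R]_n) (t : R), 0 <= t -> t <= 1 ->
      f (t *: x + (1 - t) *: y) <=
        t * f x + (1 - t) * f y - c / 2 * t * (1 - t) * norm2 (x - y) ^+ 2) ->
  forall x y, f x + dot (grad f x) (y - x) + c / 2 * dot (y - x) (y - x) <= f y.
Proof.
move=> df cvx x y; set v := y - x; set N := dot v v.
have dv : derivable f x v by exact: diff_derivable.
have H1 : h^-1 *: ((f \o shift x) (h *: v) - f x) @[h --> 0^'+] --> dot (grad f x) v.
  rewrite -derive_grad//; apply: cvg_trans; last exact: dv.
  by apply: cvg_app; apply: within_subset => h /=; rewrite lt0r => /andP[].
have H2 : f y - f x - c / 2 * (1 - h) * N @[h --> 0^'+] --> f y - f x - c / 2 * N.
  rewrite -[X in _ --> _ - X * N](_ : c / 2 * (1 - 0) = _); last by rewrite subr0 mulr1.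
  apply: cvgB; first exact: cvg_cst.
  apply: cvgMl; apply: cvgMr; apply: cvgB; first exact: cvg_cst.
  exact: cvg_within_filter cvg_id.
have : dot (grad f x) v <= f y - f x - c / 2 * N.
  apply: ler_cvg_to H1 H2 _; near=> h.
  have h0 : 0 < h by [].
  have h1 : h <= 1 by near: h; apply: nbhs_right_le.
  rewrite /GRing.scale /= ler_pdivrMl//.
  have := cvx y x h (ltW h0) h1; rewrite sqr_norm2 -/v -/N.
  have -> : h *: y + (1 - h) *: x = h *: v + x.
    by rewrite scalerBl scale1r scalerBr addrCA addrC.
  move=> ?; lra.
lra.
Unshelve. all: by end_near. Qed.

(** * Exponential decay *)

(** Gronwall's inequality: [expR (mu * t) * V t] does not increase. *)
Lemma lyapunov_decay {R : realType} (V dV : R -> R) mu :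
    {within `[0, +oo[, continuous V} ->
    (forall t : R, 0 < t -> is_derive t 1 V (dV t)) ->
    (forall t : R, 0 < t -> dV t <= - mu * V t) ->
  forall t, 0 <= t -> V t <= V 0 * expR (- mu * t).
Proof.
move=> cV DV leV t t0.
pose W (s : R) : R := expR (mu * s) * V s.
have DW (s : R) : 0 < s ->
    is_derive s 1 W (expR (mu * s) * (dV s + mu * V s)).
  move=> s0; have ? := DV s s0.
  have De : is_derive s 1 (fun r => expR (mu * r)) (mu * expR (mu * s)).
    by apply: is_derive_eq; rewrite /GRing.scale /=; ring.
  by apply: is_derive_eq; rewrite /GRing.scale /=; ring.
have : W t <= W 0.
  apply: (@ler0_derive1_nincry _ W 0) => //.
  - by move=> s; rewrite in_itv/= andbT => s0; have [] := DW s s0.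
  - move=> s; rewrite in_itv/= andbT => s0.
    rewrite derive1E (@derive_val _ _ _ _ _ _ _ (DW s s0)).
    rewrite pmulr_rle0 ?expR_gt0//; have := leV s s0; lra.
  - have cE : {within `[0, +oo[, continuous (fun r : R => expR (mu * r))}.
      apply: continuous_subspaceT => r.
      apply: continuous_comp; last exact: continuous_expR.
      exact: mulrl_continuous.
    by move=> s; apply: cvgM; [exact: cE|exact: cV].
rewrite /W mulr0 expR0 mul1r => H.
by rewrite mulNr expRN ler_pdivlMr ?expR_gt0// mulrC.
Qed.

(** * Error dynamics *)

(** At rest the integrator sees no input, which is complementary slackness:
    the multiplier is its own update. *)
Lemma multiplier_col_eq {R : realType} {m n : nat} (f : 'cV[R]_n -> R)
    (C : 'M[R]_(m, n)) d rho Ki Kp xs lams :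
  0 < rho -> 0 < Ki -> is_equilibrium f C d rho Ki Kp xs lams ->
  multiplier_col C d rho xs lams = lams /\
  grad f xs = - (C^T *m multiplier_col C d rho xs lams).
Proof.
move=> rho0 Ki0 [ex el]; split; last first.
  by move: ex => /eqP; rewrite /xrhs grad_gfun_x// subr_eq0 => /eqP <-; rewrite opprK.
move: el; rewrite ex /lamrhs mulmx0 scaler0 addr0 grad_gfun_lam// scalerA => /eqP.
by rewrite scaler_eq0 mulf_eq0 invr_eq0 !gt_eqF//= subr_eq0 => /eqP.
Qed.

Lemma error_dynamics {R : realType} {m n : nat} (f : 'cV[R]_n -> R)
    (C : 'M[R]_(m, n)) d rho Ki Kp xs lams x lam :
    0 < rho -> 0 < Ki -> is_equilibrium f C d rho Ki Kp xs lams ->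
    is_solution f C d rho Ki Kp x lam ->
  forall t : R, 0 < t ->
  let U := multiplier_col C d rho (x t) (lam t) - multiplier_col C d rho xs lams in
  let dx := - (grad f (x t) - grad f xs) - C^T *m U in
  is_derive t 1 x dx /\
  is_derive t 1 lam
    ((Ki / rho) *: (U - (lam t - lams)) + Kp *: (C *m dx)).
Proof.
move=> rho0 Ki0 /(multiplier_col_eq _ _ _ _ _ _ _ _ rho0 Ki0)[es gs] [_ _ sol] t t0 U dx.
have [dvx dvl ex el] := sol t t0.
have edx : derive1 x t = dx.
  rewrite ex /xrhs grad_gfun_x// /dx /U mulmxBr gs.
  move: (C^T *m _) (C^T *m _) (grad f _) => a b c.
  by apply/matrixP => i j; rewrite !mxE; ring.
split; first by split=> //; rewrite -derive1E.
split=> //; rewrite -derive1E el edx /lamrhs grad_gfun_lam// scalerA.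
by congr (_ *: _ + _); rewrite /U es; apply/matrixP => i j; rewrite !mxE; lra.
Qed.

(** * Decay at the prescribed rate *)

(** In terms of Q = Gamma L, D = L - Q, P = C^T L, T = C^T D and Z = G X, the left
    hand side is
    - 2 Ki X.Z - 2 (Ki / rho) L.D - 2 Kp P.Z - 2 Kp P.(P - T).
    Young's inequality replaces - 2 P.Z by P.P + Z.Z and 2 P.T by
    P.P / 2 + 2 T.T.  The term Z.Z costs g_hi^2 X.X, the term T.T is absorbed by
    L.D >= D.D thanks to the gain bound on [C^T], and half of P.P survives. *)
Lemma sector_dissipation {R : realType} {m n : nat} (C : 'M[R]_(m, n)) (G : 'M[R]_n)
    (gam : 'rV[R]_m) (rho Ki Kp c_lo g_lo g_hi mu : R) X L U dX dL :
    0 < rho -> 0 < Ki -> 0 < Kp -> 0 < g_lo -> 0 < g_hi ->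
    (forall j, 0 <= gam 0 j <= 1) ->
    loewner_le c_lo%:M (C *m C^T) ->
    loewner_le g_lo%:M G -> loewner_le G g_hi%:M ->
    (forall q, rho * Kp * dot (C^T *m q) (C^T *m q) <= Ki * dot q q) ->
    mu <= 1 / 2 * Kp * c_lo -> mu * Ki <= 2 * Ki * g_lo - Kp * g_hi ^+ 2 ->
  U = diag_mx gam *m (rho *: (C *m X) + L) ->
  dX = - ((G - rho *: (C^T *m diag_mx gam *m C)) *m X) - C^T *m U ->
  dL = (Ki / rho) *: (U - L) + Kp *: (C *m dX) ->
  Ki * (dot dX X + dot X dX) + (dot dL L + dot L dL) <=
    - mu * (Ki * dot X X + dot L L).
Proof.
move=> rho0 Ki0 Kp0 glo0 ghi0 gam01 CC Glo Ghi CT mu1 mu2 eU edX edL.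
pose Q := diag_mx gam *m L; pose D := L - Q.
pose Y := C *m X; pose P := C^T *m L; pose Z := G *m X; pose T := C^T *m D.
have Gt : G^T = G.
  by have [+ _] := Glo; rewrite linearB /= tr_scalar_mx => /addIr.
have DD : dot D D <= dot L D.
  apply: ler_sum => i _; rewrite /D /Q mul_diag_mx !mxE.
  have /andP[g0 g1] := gam01 i; have := mulr_ge0 (mulr_ge0 g0 (sqr_ge0 (L i 0))).
  move=> /(_ (1 - gam 0 i)); rewrite subr_ge0 => /(_ g1); nra.
have eX : dX = - Z - (P - T).
  rewrite edX eU /P /T /D mulmxBl opprB mulmxDr (mulmxDr C^T) -/Q -/Z.
  rewrite -scalemxAl -!scalemxAr -!mulmxA mulmxBr subKr.
  move: (G *m X) (rho *: _) (C^T *m Q) => a b c.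
  by apply/matrixP => i j; rewrite !mxE; ring.
(* This Q.Y cancels the one of X.X' below once weighted by Ki. *)
have LU : dot L (U - L) = rho * dot Q Y - dot L D.
  rewrite eU mulmxDr -/Q -scalemxAr -/Y /D !dotE dot_trmx tr_diag_mx -/Q; ring.
have LdX : dot L (C *m dX) = dot P dX by rewrite dot_trmx.
have XQ : dot X dX = - dot X Z - dot Q Y.
  have -> : dX = - Z - C^T *m Q by rewrite eX /P /T /D mulmxBr subKr.
  by rewrite !dotE dot_trmx trmxK (dotC _ Q).
have ZZ : dot Z Z <= g_hi ^+ 2 * dot X X.
  apply: sqr_mulmx_le => // w; last exact: loewner_le_scalar.
  apply: le_trans (loewner_scalar_le _ _ _ Glo).
  by rewrite mulr_ge0 ?dot_ge0 ?ltW.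
have XZ : g_lo * dot X X <= dot X Z by exact: loewner_scalar_le.
have PP : c_lo * dot L L <= dot P P.
  apply: le_trans (loewner_scalar_le _ _ _ CC) _.
  by rewrite -mulmxA dot_trmx.
have TT : rho * Kp * dot T T <= Ki * dot D D by exact: CT.
clearbody T P Z Y D Q.
rewrite (dotC dX) (dotC dL) XQ edL dotDr !dotZr LU LdX eX !dotE.
have y1 := young2 (- P) Z 1; have y2 := young2 P T (1/2).
rewrite !dotE in y1 y2.
have key : 2 * Kp * dot T T <= 2 * Ki / rho * dot L D.
  rewrite -(ler_pM2l rho0).
  rewrite (_ : rho * (2 * Ki / rho * dot L D) = 2 * Ki * dot L D); last first.
    by field; rewrite gt_eqF.
  have : Ki * dot D D <= Ki * dot L D by rewrite ler_pM2l.
  lra.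
have Ky1 : 0 <= Kp * (dot P P + dot Z Z + 2 * dot P Z) by apply: (mulr_ge0 (ltW Kp0)); lra.
have Ky2 : 0 <= Kp * (2^-1 * dot P P + 2 * dot T T - 2 * dot P T).
  by apply: (mulr_ge0 (ltW Kp0)); lra.
have KZZ : Kp * dot Z Z <= Kp * (g_hi ^+ 2 * dot X X) by rewrite ler_pM2l.
have KXZ : Ki * (g_lo * dot X X) <= Ki * dot X Z by rewrite ler_pM2l.
have KPP : Kp * (c_lo * dot L L) <= Kp * dot P P by rewrite ler_pM2l.
have m1 := ler_wpM2r (dot_ge0 L) mu1.
have m2 := ler_wpM2r (dot_ge0 X) mu2.
rewrite (_ : Ki / rho * (rho * dot Q Y - dot L D) =
  Ki * dot Q Y - Ki / rho * dot L D); last by field; rewrite gt_eqF.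
move: key; rewrite -(mulrA 2 Ki) -(mulrA 2 (_ / _)); move: (Ki / rho * dot L D) => LD key.
lra.
Qed.

(** ** Gain of the integral action *)

(** The state is frozen at [xs] and every multiplier is shifted by [tau] or by
    [- tau].  As [tau] exceeds four times the modulus of every argument of the positive
    part at the reference point, the secant slopes are at least 3/4 and at most
    1/4 respectively; their gap multiplies [C^T *m C] and has to fit between
    [g_lo] and [g_hi]. *)
Lemma multiplier_gain {R : realType} {m n : nat} (C : 'M[R]_(m, n)) d rho xs lams
    (B : 'M[R]_n) gamma g_lo g_hi :
    0 < rho -> is_secant_gamma C d rho xs lams gamma ->
    (forall lam,
      loewner_le g_lo%:M (B + rho *: (C^T *m diag_mx (gamma xs lam) *m C)) /\
      loewner_le (B + rho *: (C^T *m diag_mx (gamma xs lam) *m C)) g_hi%:M) ->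
  forall v, rho * dot (C *m v) (C *m v) <= 2 * (g_hi - g_lo) * dot v v.
Proof.
move=> rho0 gammaP GB v.
pose s j := rho * hfun C d xs j 0 + lams j 0.
pose tau : R := 4 * (1 + \sum_j `|s j|).
have tau0 : 0 < tau by rewrite mulr_gt0// ltr_pwDl// sumr_ge0.
have sle j : 4 * `|s j| <= tau.
  rewrite ler_pM2l// (bigD1 j)//= addrCA lerDl addr_ge0//.
  by rewrite sumr_ge0.
have gamE (a : R) j : pospart (s j + a) - pospart (s j) =
    gamma xs (lams + const_mx a) 0 j * a.
  have [_] := gammaP xs (lams + const_mx a) j.
  rewrite /updated_multiplier [(lams + _) j 0]mxE [const_mx a j 0]mxE !addrA.
  rewrite (_ : rho * (_ - _) + _ + a - _ = a); first exact.
  ring.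
(* Multiplied by tau, the slopes are at least tau + s j - pospart (s j) and
   equal to pospart (s j), so they differ by at least tau - |s j|. *)
have gap j : 1 / 2 <= gamma xs (lams + const_mx tau) 0 j -
    gamma xs (lams + const_mx (- tau)) 0 j.
  rewrite -(ler_pM2r tau0); have := gamE tau j; have := gamE (- tau) j.
  move: (gamma _ _ _ _) (gamma _ _ _ _) (sle j) => g1 g2.
  have := pospart_ge0 (s j); have := pospart_gap (s j + tau).
  have -> : pospart (s j - tau) = 0.
    apply/max_idPr; have := ler_norm (s j); have := sle j; lra.
  have : 2 * pospart (s j) - s j <= `|s j|.
    have := ler_norm (s j); have := ler_norm (- s j); rewrite normrN /pospart.
    by case: (leP (s j) 0) => _; lra.
  lra.
have quadG (lam : 'cV[R]_m) :
    dot v ((B + rho *: (C^T *m diag_mx (gamma xs lam) *m C)) *m v) =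
    dot v (B *m v) + rho * \sum_j gamma xs lam 0 j * (C *m v) j 0 ^+ 2.
  rewrite mulmxDl dotDr -scalemxAl dotZr -!mulmxA (dot_trmx C^T) trmxK.
  congr (_ + _ * _); apply: eq_bigr => j _; rewrite mul_diag_mx [X in _ * X]mxE; ring.
have lo := loewner_scalar_le _ _ v (GB (lams + const_mx (- tau))).1.
have hi := loewner_le_scalar _ _ v (GB (lams + const_mx tau)).2.
rewrite !quadG in lo hi.
have : 1 / 2 * dot (C *m v) (C *m v) <=
    \sum_j gamma xs (lams + const_mx tau) 0 j * (C *m v) j 0 ^+ 2 -
    \sum_j gamma xs (lams + const_mx (- tau)) 0 j * (C *m v) j 0 ^+ 2.
  rewrite -sumrB mulr_sumr; apply: ler_sum => j _.
  by rewrite -mulrBl -expr2 ler_wpM2r ?sqr_ge0.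
move=> /(ler_wpM2l (ltW rho0)); lra.
Qed.

(** * Boundedness without a rate *)

(** Bregman distance from [p] to [s] of the convex potential max(s, 0)^2 / 2. *)
Definition pos_bregman {R : realType} (p s : R) : R :=
  2^-1 * (pospart s ^+ 2 - pospart p ^+ 2) - pospart p * (s - p).

Lemma pos_bregman_ge0 {R : realType} (p s : R) : 0 <= pos_bregman p s.
Proof.
rewrite /pos_bregman.
have := mulr_ge0 (pospart_ge0 p) (pospart_gap s).
have := pospart_compl p; have := sqr_ge0 (pospart s - pospart p); nra.
Qed.

Lemma is_derive_pos_bregman {R : realType} (p s : R) :
  is_derive s 1 (pos_bregman p) (pospart s - pospart p).
Proof.
have D := is_derive_sqr_pospart s.
by apply: is_derive_eq; rewrite /GRing.scale /=; field.
Qed.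

(** Here [v] is the gradient error and [S] the error of rho h + lam.  The left hand
    side is the derivative of the Lur'e function of [error_bounded].  With
    r = rho + Kp and E = S - U it equals
    - (1 + q Ki) X.v - q r X'.X' - ((1 + q Ki) / rho) U.E
    - r Y.Y + (1 + r / rho) Y.E - E.E / rho :
    the weight 1 + q Ki on |X|^2 / 2 is the one that cancels Y.U, and the two
    Bregman terms combine into - q r |X'|^2.  The indefinite form in [Y] and [E]
    is compensated by X.v once [q] is large. *)
Lemma lure_dissipation {R : realType} {m n : nat} (C : 'M[R]_(m, n))
    (rho Ki Kp q c c_hi : R) X v (L U Y S W : 'cV[R]_m) dX dL :
    0 < rho -> 0 < Ki -> 0 < Kp -> 0 <= q -> 0 < c ->
    c * dot X X <= dot X v ->
    dot Y Y <= c_hi * dot X X ->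
    rho * (1 + (rho + Kp) / rho) ^+ 2 / 4 * c_hi <= q * Ki * c ->
    Y = C *m X -> S = rho *: Y + L -> W = L - Kp *: Y ->
    0 <= dot U (S - U) ->
    dX = - v - C^T *m U ->
    dL = (Ki / rho) *: (U - L) + Kp *: (C *m dX) ->
  (1 + q * Ki) * dot X dX + Ki^-1 * dot W (dL - Kp *: (C *m dX)) +
  q * (rho + Kp) * dot v dX + q * dot U (rho *: (C *m dX) + dL) <= 0.
Proof.
move=> rho0 Ki0 Kp0 q0 c0 Xv YX qle eY eS eW UE edX edL.
have rhoN0 : rho != 0 by rewrite gt_eqF.
pose E := S - U; rewrite -/E in UE.
have eL : L = U + E - rho *: Y.
  by rewrite /E eS; apply/matrixP => i j; rewrite !mxE; ring.
have eUL : U - L = rho *: Y - E.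
  by rewrite eL; apply/matrixP => i j; rewrite !mxE; ring.
have {}eW : W = U + E - (rho + Kp) *: Y.
  by rewrite eW eL; apply/matrixP => i j; rewrite !mxE; ring.
have UC : dot U (C *m dX) = dot (C^T *m U) dX by rewrite dot_trmx.
have XdX : dot X dX = - dot X v - dot Y U.
  by rewrite edX !dotE dot_trmx trmxK -eY.
have dXdX : dot v dX + dot (C^T *m U) dX = - dot dX dX.
  by rewrite -dotDl {2}edX -opprD dotNl opprK.
rewrite edL addrK eUL; clear edX edL eUL eL.
clearbody E; rewrite eW !dotE UC XdX !(dotC _ Y).
(* The scaling of Young's inequality is dictated by the available E.E / rho. *)
have young : (1 + (rho + Kp) / rho) * dot Y E <=
   rho^-1 * dot E E + rho * (1 + (rho + Kp) / rho) ^+ 2 / 4 * dot Y Y.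
  have := young2 Y E (rho * (1 + (rho + Kp) / rho) / 2).
  rewrite -(ler_pM2l rho0) => h; rewrite -(ler_pM2l rho0).
  have -> : rho * (rho^-1 * dot E E + rho * (1 + (rho + Kp) / rho) ^+ 2 / 4 * dot Y Y)
    = dot E E + (rho * (1 + (rho + Kp) / rho) / 2) ^+ 2 * dot Y Y by field.
  by move: h; rewrite ler_pM2l//; lra.
have h1 : 0 <= q * (rho + Kp) * dot dX dX.
  by rewrite !mulr_ge0 ?dot_ge0// addr_ge0// ltW.
have h2 : rho * (1 + (rho + Kp) / rho) ^+ 2 / 4 * dot Y Y <= q * Ki * c * dot X X.
  apply: le_trans (ler_wpM2r (dot_ge0 X) qle); rewrite -(mulrA _ c_hi).
  by rewrite ler_wpM2l// divr_ge0// mulr_ge0 ?sqr_ge0// ltW.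
have h3 : q * Ki * c * dot X X <= (1 + q * Ki) * dot X v.
  have : q * Ki * (c * dot X X) <= q * Ki * dot X v.
    by rewrite ler_wpM2l// mulr_ge0// ltW.
  have : 0 <= c * dot X X by rewrite mulr_ge0 ?dot_ge0// ltW.
  lra.
have h4 : 0 <= rho^-1 * (1 + q * Ki) * dot U E.
  by rewrite !mulr_ge0 ?invr_ge0 ?addr_ge0 ?mulr_ge0// ltW.
have h5 : 0 <= (rho + Kp) * dot Y Y by rewrite mulr_ge0 ?dot_ge0// addr_ge0// ltW.
set lhs := (X in X <= 0).
(* X' stays symbolic: v and C^T U occur only through the sum v + C^T U = - X'. *)
suff -> : lhs = - (1 + q * Ki) * dot X v - q * (rho + Kp) * dot dX dX
  - rho^-1 * (1 + q * Ki) * dot U E - (rho + Kp) * dot Y Y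
  + (1 + (rho + Kp) / rho) * dot Y E - rho^-1 * dot E E by lra.
rewrite /lhs (_ : dot dX dX = - (dot v dX + dot (C^T *m U) dX)); last lra.
by field; rewrite rhoN0 gt_eqF.
Qed.

(** * Continuity along a trajectory *)

Lemma cvg_coord {R : realType} {T : Type} {F : set_system T} {FF : Filter F}
    {m n : nat} (u : T -> 'M[R]_(m, n)) (a : 'M[R]_(m, n)) i j :
  u @ F --> a -> u s i j @[s --> F] --> a i j.
Proof.
move=> H; apply: (cvg_comp u (fun M : 'M[R]_(m, n) => M i j) H).
exact: coord_continuous.
Qed.

Lemma cvg_mx {R : realType} {T : Type} {F : set_system T} {FF : Filter F}
    {m n : nat} (u : T -> 'M[R]_(m, n)) (a : 'M[R]_(m, n)) :
  (forall i j, u s i j @[s --> F] --> a i j) -> u @ F --> a.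
Proof.
move=> H; apply/cvgrPdist_le => e e0; near=> s.
rewrite /Num.Def.normr/= mx_normrE (bigmax_le _ (ltW e0))//= => ij _.
rewrite !mxE; move: ij; near: s; apply: filter_forall => ij.
exact: ((cvgrPdist_le _ _).1 (H ij.1 ij.2)).
Unshelve. all: by end_near. Qed.

Lemma cvg_dot {R : realType} {T : Type} {F : set_system T} {FF : Filter F}
    {n : nat} (u v : T -> 'cV[R]_n) (a b : 'cV[R]_n) :
  u @ F --> a -> v @ F --> b -> dot (u s) (v s) @[s --> F] --> dot a b.
Proof.
move=> ua vb; apply: cvg_big => [|i _]; first exact: add_continuous.
by apply: cvgM; exact: cvg_coord.
Qed.

Lemma cvg_mulmx {R : realType} {T : Type} {F : set_system T} {FF : Filter F}
    {m n : nat} (A : 'M[R]_(m, n)) (u : T -> 'cV[R]_n) (a : 'cV[R]_n) :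
  u @ F --> a -> A *m u s @[s --> F] --> A *m a.
Proof.
move=> ua; apply: cvg_mx => i j; rewrite mxE.
under eq_fun do rewrite mxE.
apply: cvg_big => [|k _]; first exact: add_continuous.
by apply: cvgMr; exact: cvg_coord.
Qed.

(** * Convergence *)

Lemma norm2_le_expR {R : realType} {n : nat} (v : 'cV[R]_n) K mu t :
  0 <= K -> dot v v <= K * expR (- mu * t) ->
  norm2 v <= (Num.sqrt K + 1) * expR (- (1 / 2) * mu * t).
Proof.
move=> K0 vK; have e0 := expR_gt0 (- (1 / 2) * mu * t).
have e2 : expR (- mu * t) = expR (- (1 / 2) * mu * t) ^+ 2.
  by rewrite -expRM_natl; congr expR; field.
have sK := sqrtr_ge0 K; have sKK := sqr_sqrtr K0.
rewrite -(@ler_pXn2r _ 2) ?nnegrE ?mulr_ge0 ?sqrtr_ge0 ?addr_ge0 ?expR_ge0//.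
rewrite sqr_norm2 (le_trans vK)// e2 exprMn ler_wpM2r ?sqr_ge0//.
rewrite -{1}sKK; nra.
Qed.

(** Integrates [sector_dissipation] along a solution. *)
Lemma rate_decay {R : realType} {m n : nat} (f : 'cV[R]_n -> R)
    (C : 'M[R]_(m, n)) d (rho Ki Kp c_lo : R) xs lams B gamma
    (g_lo g_hi mu : R) x lam :
    0 < rho -> 0 < Ki -> 0 < Kp ->
    loewner_le c_lo%:M (C *m C^T) ->
    is_equilibrium f C d rho Ki Kp xs lams ->
    is_secant_matrix f xs B ->
    is_secant_gamma C d rho xs lams gamma ->
    0 < g_lo -> g_lo <= g_hi ->
    (forall x lam,
      loewner_le g_lo%:M (B x + rho *: (C^T *m diag_mx (gamma x lam) *m C)) /\
      loewner_le (B x + rho *: (C^T *m diag_mx (gamma x lam) *m C)) g_hi%:M) ->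
    0 <= mu -> mu <= 1 / 2 * Kp * c_lo ->
    mu * Ki <= 2 * Ki * g_lo - Kp * g_hi ^+ 2 ->
    is_solution f C d rho Ki Kp x lam ->
  let V t := Ki * dot (x t - xs) (x t - xs) + dot (lam t - lams) (lam t - lams) in
  forall t, 0 <= t -> V t <= V 0 * expR (- mu * t).
Proof.
move=> rho0 Ki0 Kp0 CC eqz BP gP glo0 glohi GB mu0 mu1 mu2 sol V.
have ghi0 : 0 < g_hi by exact: lt_le_trans glohi.
have gain q : rho * Kp * dot (C^T *m q) (C^T *m q) <= Ki * dot q q.
  have rK0 : 0 < rho * Kp by rewrite mulr_gt0.
  rewrite -ler_pdivlMl// mulrA (mulrC _ Ki); apply: sqr_trmx_le q => [|v].
    by rewrite divr_gt0.
  have := multiplier_gain C d rho xs lams (B xs) gamma g_lo g_hi rho0 gP (GB xs) v.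
  rewrite -mulrA (mulrC Ki) -mulrA ler_pdivlMl// => h.
  have N0 := dot_ge0 v.
  (* Because 4 g_lo (g_hi - g_lo) <= g_hi^2 and Kp g_hi^2 <= 2 Ki g_lo. *)
  have h1 : 2 * Kp * (g_hi - g_lo) <= Ki.
    rewrite -(ler_pM2l glo0).
    have := mulr_ge0 mu0 (ltW Ki0).
    have := mulr_ge0 (ltW Kp0) (sqr_ge0 (g_hi - 2 * g_lo)); nra.
  have := ler_wpM2r N0 h1; have := ler_wpM2l (ltW Kp0) h; lra.
have [cx cl _] := sol.
pose U (t : R) : 'cV[R]_m := multiplier_col C d rho (x t) (lam t) - multiplier_col C d rho xs lams.
pose dx (t : R) : 'cV[R]_n := - (grad f (x t) - grad f xs) - C^T *m U t.
pose dl (t : R) : 'cV[R]_m := (Ki / rho) *: (U t - (lam t - lams)) + Kp *: (C *m dx t).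
have dyn (t : R) : 0 < t -> is_derive t 1 x (dx t) /\ is_derive t 1 lam (dl t).
  exact: error_dynamics rho0 Ki0 eqz sol t.
apply: (lyapunov_decay V (fun t =>
  Ki * (dot (dx t) (x t - xs) + dot (x t - xs) (dx t)) +
  (dot (dl t) (lam t - lams) + dot (lam t - lams) (dl t)))).
- move=> s; apply: cvgD; [apply: cvgMr|]; apply: cvg_dot;
    by apply: cvgB; [(exact: cx || exact: cl)|exact: cvg_cst].
- move=> t t0; have [Dx Dl] := dyn t t0.
  have Dx' : is_derive t 1 (fun s => x s - xs) (dx t).
    by apply: is_derive_eq; rewrite subr0.
  have Dl' : is_derive t 1 (fun s => lam s - lams) (dl t).
    by apply: is_derive_eq; rewrite subr0.
  exact: is_deriveD (is_deriveZ Ki (is_derive_dot _ _ _ _ _ Dx' Dx'))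
    (is_derive_dot _ _ _ _ _ Dl' Dl').
- move=> t t0; have [G1 G2] := GB (x t) (lam t).
  apply: (sector_dissipation C _ (gamma (x t) (lam t)) rho Ki Kp c_lo g_lo g_hi mu
    _ _ (U t) (dx t) (dl t) _ _ _ _ _ _ _ G1 G2) => //.
  + by move=> j; have [] := gP (x t) (lam t) j.
  + apply/matrixP => j k; rewrite (ord1 k) mul_diag_mx.
    have [_ gE] := gP (x t) (lam t) j.
    have -> : U t j 0 = updated_multiplier C d rho (x t) (lam t) j -
        updated_multiplier C d rho xs lams j by rewrite /U /multiplier_col !mxE.
    rewrite gE [RHS]mxE; congr (_ * _).
    by rewrite /hfun mulmxBr !mxE; ring.
  + by rewrite /dx addrK (BP (x t)).2.
Qed.

(** The Lur'e function [V] below does not increase and dominates a positive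
    definite quadratic form of [X] and [W], hence of the errors of [x] and [lam]. *)
Lemma error_bounded {R : realType} {m n : nat} (f : 'cV[R]_n -> R)
    (C : 'M[R]_(m, n)) d (rho Ki Kp c_hi : R) xs lams x lam :
    smooth f -> strongly_convex f ->
    0 < rho -> 0 < Ki -> 0 < Kp -> 0 < c_hi ->
    loewner_le (C *m C^T) c_hi%:M ->
    is_equilibrium f C d rho Ki Kp xs lams ->
    is_solution f C d rho Ki Kp x lam ->
  exists2 K, 0 <= K & forall t, 0 <= t ->
    dot (x t - xs) (x t - xs) <= K /\ dot (lam t - lams) (lam t - lams) <= K.
Proof.
move=> [df _] [c c0 cvx] rho0 Ki0 Kp0 chi0 CC eqz sol.
have [rho0' Ki0' Kp0'] := And3 (ltW rho0) (ltW Ki0) (ltW Kp0).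
have [c0' chi0'] := conj (ltW c0) (ltW chi0).
have tangent := strongly_convex_tangent f c df cvx.
have CX v : dot (C *m v) (C *m v) <= c_hi * dot v v.
  rewrite -{1 2}(trmxK C); apply: sqr_trmx_le => // p.
  by rewrite -dot_trmx mulmxA; exact: loewner_le_scalar.
have [cx cl _] := sol.
pose U (t : R) : 'cV[R]_m :=
  multiplier_col C d rho (x t) (lam t) - multiplier_col C d rho xs lams.
pose v (t : R) : 'cV[R]_n := grad f (x t) - grad f xs.
pose dx (t : R) : 'cV[R]_n := - v t - C^T *m U t.
pose dl (t : R) : 'cV[R]_m := (Ki / rho) *: (U t - (lam t - lams)) + Kp *: (C *m dx t).
have dyn (t : R) : 0 < t -> is_derive t 1 x (dx t) /\ is_derive t 1 lam (dl t).
  exact: error_dynamics rho0 Ki0 eqz sol t.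
(* The least weight of the Bregman terms that meets the requirement of
   [lure_dissipation]. *)
pose q : R := rho * (1 + (rho + Kp) / rho) ^+ 2 / 4 * c_hi / (Ki * c).
have q0 : 0 <= q.
  apply: divr_ge0 (mulr_ge0 _ chi0') (mulr_ge0 Ki0' c0').
  exact: divr_ge0 (mulr_ge0 rho0' (sqr_ge0 _)) (ler0n _ 4).
pose X (t : R) : 'cV[R]_n := x t - xs.
pose W (t : R) : 'cV[R]_m := (lam t - lams) - Kp *: (C *m X t).
pose s0 : 'cV[R]_m := rho *: (C *m xs - d) + lams.
pose s (t : R) : 'cV[R]_m := rho *: (C *m x t - d) + lam t.
pose ftilde (t : R) : R := f (x t) - f xs - dot (grad f xs) (X t).
pose phi (t : R) : R := \sum_j pos_bregman (s0 j 0) (s t j 0).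
pose V (t : R) : R := (1 + q * Ki) / 2 * dot (X t) (X t)
  + Ki^-1 / 2 * dot (W t) (W t) + q * (rho + Kp) * ftilde t + q * phi t.
have UE t j : U t j 0 = pospart (s t j 0) - pospart (s0 j 0).
  rewrite /U /multiplier_col !mxE /updated_multiplier -!/(pospart _).
  by congr (pospart _ - pospart _); rewrite /s /s0 /hfun !mxE.
have V_le t : 0 <= t -> V t <= V 0.
  suff : 0 <= t -> V t <= V 0 * expR (- 0 * t).
    by rewrite oppr0 mul0r expR0 mulr1.
  apply: (lyapunov_decay V (fun t => (1 + q * Ki) * dot (X t) (dx t) +
    Ki^-1 * dot (W t) (dl t - Kp *: (C *m dx t)) +
    q * (rho + Kp) * dot (v t) (dx t) +
    q * dot (U t) (rho *: (C *m dx t) + dl t)) 0).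
  - have cX : {within `[0, +oo[, continuous X}.
      by move=> r; apply: cvgB; [exact: cx|exact: cvg_cst].
    have cs : {within `[0, +oo[, continuous s}.
      move=> r; apply: cvgD; last exact: cl.
      apply: cvgZl_tmp; apply: cvgB; last exact: cvg_cst.
      by apply: cvg_mulmx; exact: cx.
    have cW : {within `[0, +oo[, continuous W}.
      move=> r; apply: cvgB; last by apply: cvgZl_tmp; apply: cvg_mulmx; exact: cX.
      by apply: cvgB; [exact: cl|exact: cvg_cst].
    move=> r; apply: cvgD; [apply: cvgD; [apply: cvgD|]|]; apply: cvgMr.
    + by apply: cvg_dot; exact: cX.
    + by apply: cvg_dot; exact: cW.
    + apply: cvgB; last by apply: cvg_dot; [exact: cvg_cst|exact: cX].
      apply: cvgB; last exact: cvg_cst.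
      apply: (cvg_comp x f (cx r)).
      exact: (differentiable_continuous (df _)).
    + apply: cvg_big => [|j _]; first exact: add_continuous.
      apply: (cvg_comp (fun r => s r j 0) (pos_bregman (s0 j 0))
        (cvg_coord _ _ _ _ (cs r))).
      apply: differentiable_continuous; apply/derivable1_diffP.
      by have [] := is_derive_pos_bregman (s0 j 0) (s r j 0).
  - move=> {}t t0; have [Dx Dl] := dyn t t0.
    have DX : is_derive t 1 X (dx t) by apply: is_derive_eq; rewrite subr0.
    have DW : is_derive t 1 W (dl t - Kp *: (C *m dx t)).
      have ? := is_derive_mulmx C X _ _ DX.
      by apply: is_derive_eq; rewrite subr0.
    have Ds : is_derive t 1 s (rho *: (C *m dx t) + dl t).
      have ? := is_derive_mulmx C x _ _ Dx.
      by apply: is_derive_eq; rewrite subr0.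
    have Df : is_derive t 1 ftilde (dot (v t) (dx t)).
      have Df' := is_derive_comp_grad f x _ _ (df _) Dx.
      have Dc : is_derive t 1 (fun=> grad f xs) 0 by exact: is_derive_cst.
      have Dd := is_derive_dot _ _ _ _ _ Dc DX.
      apply: (is_derive_eq (is_deriveB (is_deriveB Df' (is_derive_cst (f xs) t 1)) Dd)).
      have d0 : dot 0 (X t) = 0 by rewrite -(scale0r (0 : 'cV[R]_n)) dotZl mul0r.
      by rewrite subr0 d0 add0r /v dotDl dotNl.
    have Dphi : is_derive t 1 phi (dot (U t) (rho *: (C *m dx t) + dl t)).
      apply: is_derive_big => j; rewrite UE.
      have Dsj := (is_derive_mx _ _ _ _).1 Ds j 0.
      exact: (is_derive1_comp (is_derive_pos_bregman _ _) Dsj).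
    have DXX := is_derive_dot _ _ _ _ _ DX DX.
    have DWW := is_derive_dot _ _ _ _ _ DW DW.
    apply: is_derive_eq.
    rewrite /GRing.scale /= (dotC (dx t)) (dotC (_ - _) (W t)); field.
    by rewrite gt_eqF.
  - move=> {}t t0; rewrite oppr0 mul0r.
    apply: (lure_dissipation C rho Ki Kp q c c_hi (X t) (v t) (lam t - lams) (U t)
      (C *m X t) (s t - s0)) => //.
    + have := tangent (x t) xs; have := tangent xs (x t).
      rewrite -/(X t) -(opprB (x t) xs) -/(X t) /v; move: (X t) => Xt.
      by rewrite !dotE !(dotC Xt (grad _ _)); lra.
    + by rewrite -(mulrA q) /q mulfVK// mulf_neq0// gt_eqF.
    + rewrite /s /s0 /X mulmxBr; move: (C *m x t) (C *m xs) => a b.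
      by apply/matrixP => i j; rewrite !mxE; ring.
    + apply: sumr_ge0 => j _.
      have subE (a b w : 'cV[R]_m) : (a - b - w) j 0 = a j 0 - b j 0 - w j 0.
        by rewrite !mxE.
      by rewrite subE UE; exact: pospart_firm.
have V_ge t : (1 + q * Ki) / 2 * dot (X t) (X t) + Ki^-1 / 2 * dot (W t) (W t) <= V t.
  have ft0 : 0 <= ftilde t.
    have := tangent xs (x t); rewrite -/(X t) /ftilde.
    have : 0 <= c / 2 * dot (X t) (X t) by rewrite !mulr_ge0 ?dot_ge0.
    lra.
  have phi0 : 0 <= phi t by apply: sumr_ge0 => j _; exact: pos_bregman_ge0.
  rewrite /V -addrA lerDl; apply: addr_ge0; last exact: mulr_ge0.
  exact: mulr_ge0 (mulr_ge0 q0 (addr_ge0 rho0' Kp0')) ft0.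
have V00 : 0 <= V 0.
  apply: le_trans (V_ge 0).
  have a0 : 0 <= 1 + q * Ki by rewrite addr_ge0// mulr_ge0.
  apply: addr_ge0; apply: mulr_ge0 (dot_ge0 _); apply: divr_ge0 => //.
  by rewrite invr_ge0.
exists (2 * V 0 + 4 * Ki * V 0 + 4 * Kp ^+ 2 * c_hi * V 0).
  by rewrite !addr_ge0// !mulr_ge0 ?sqr_ge0//.
move=> t t0.
have XX0 := dot_ge0 (X t); have WW0 := dot_ge0 (W t).
have le1 : (1 + q * Ki) / 2 * dot (X t) (X t) + Ki^-1 / 2 * dot (W t) (W t) <= V 0.
  exact: le_trans (V_ge t) (V_le t t0).
have qX : 0 <= q * Ki * dot (X t) (X t) by exact: mulr_ge0 (mulr_ge0 q0 Ki0') XX0.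
have KW : 0 <= Ki^-1 * dot (W t) (W t) by rewrite mulr_ge0 ?invr_ge0.
have XV : dot (X t) (X t) <= 2 * V 0 by lra.
have WV : dot (W t) (W t) <= 2 * Ki * V 0.
  have : Ki^-1 * dot (W t) (W t) <= 2 * V 0 by lra.
  rewrite ler_pdivrMl//; lra.
have h1 : 0 <= Ki * V 0 by rewrite mulr_ge0//.
have h2 : 0 <= Kp ^+ 2 * c_hi * V 0 by rewrite !mulr_ge0 ?sqr_ge0//.
split; first lra.
have -> : lam t - lams = W t + Kp *: (C *m X t) by rewrite subrK.
have h3 : Kp ^+ 2 * dot (C *m X t) (C *m X t) <= Kp ^+ 2 * (c_hi * (2 * V 0)).
  rewrite ler_wpM2l ?sqr_ge0//; apply: le_trans (CX _) _.
  by rewrite ler_wpM2l//.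
move: WV h3; move: (W t) (C *m X t) => w y WV h3.
have := young2 (Kp *: y) w 1.
rewrite !dotE (dotC y w); lra.
Qed.

Theorem theorem2 (R : realType) (m n : nat) (f : 'cV[R]_n -> R)
    (C : 'M[R]_(m, n)) (d : 'cV[R]_m) (rho Ki Kp : R)
    (f_smooth : smooth f) (f_convex : strongly_convex f)
    (rho_gt0 : 0 < rho) (Ki_gt0 : 0 < Ki) (Kp_gt0 : 0 < Kp)
    (C_full : full_rank C)
    (c_lo c_hi : R) (c_lo_gt0 : 0 < c_lo) (c_lo_hi : c_lo <= c_hi)
    (CCT_lo : loewner_le c_lo%:M (C *m C^T))
    (CCT_hi : loewner_le (C *m C^T) c_hi%:M)
    (rho_lt : rho < c_hi^-1)
    (xs : 'cV[R]_n) (lams : 'cV[R]_m)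
    (zs_eq : is_equilibrium f C d rho Ki Kp xs lams)
    (B : 'cV[R]_n -> 'M[R]_n) (B_secant : is_secant_matrix f xs B)
    (gamma : 'cV[R]_n -> 'cV[R]_m -> 'rV[R]_m)
    (gamma_secant : is_secant_gamma C d rho xs lams gamma)
    (g_lo g_hi : R) (g_lo_gt0 : 0 < g_lo) (g_lo_hi : g_lo <= g_hi)
    (G_bounds : forall (x : 'cV[R]_n) (lam : 'cV[R]_m),
        loewner_le g_lo%:M
          (B x + rho *: (C^T *m diag_mx (gamma x lam) *m C)) /\
        loewner_le (B x + rho *: (C^T *m diag_mx (gamma x lam) *m C))
          g_hi%:M)
    (mu : R)
    (mu_le : mu <= Num.min (1 / 2 * Kp * c_lo)
                           ((2 * Ki * g_lo - Kp * g_hi ^+ 2) / Ki)) :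
  forall (x : R -> 'cV[R]_n) (lam : R -> 'cV[R]_m),
    is_solution f C d rho Ki Kp x lam ->
    exists alpha1 alpha2 : R,
      [/\ 0 < alpha1, 0 < alpha2 &
        forall t : R, 0 <= t ->
          norm2 (x t - xs) <= alpha1 * expR (- (1 / 2) * mu * t) /\
          norm2 (lam t - lams) <= alpha2 * expR (- (1 / 2) * mu * t)].
Proof.
move=> x lam sol.
have chi0 : 0 < c_hi by exact: lt_le_trans c_lo_hi.
have [mu0|mu0] := leP 0 mu.
  have [mu1 mu2] : mu <= 1 / 2 * Kp * c_lo /\
      mu * Ki <= 2 * Ki * g_lo - Kp * g_hi ^+ 2.
    by move: mu_le; rewrite le_min ler_pdivlMr// => /andP[].
  have := rate_decay f C d rho Ki Kp c_lo xs lams B gamma g_lo g_hi mu x lam rho_gt0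
    Ki_gt0 Kp_gt0 CCT_lo zs_eq B_secant gamma_secant g_lo_gt0 g_lo_hi G_bounds
    mu0 mu1 mu2 sol.
  set V := fun t : R => _ => decay.
  have V0 : 0 <= V 0 by apply: addr_ge0 (mulr_ge0 (ltW Ki_gt0) _) _; exact: dot_ge0.
  exists (Num.sqrt (V 0 / Ki) + 1), (Num.sqrt (V 0) + 1).
  split; try by rewrite ltr_wpDl ?sqrtr_ge0.
  move=> t t0; have Vt := decay t t0.
  have X0 : 0 <= Ki * dot (x t - xs) (x t - xs) by exact: mulr_ge0 (ltW Ki_gt0) (dot_ge0 _).
  have L0 := dot_ge0 (lam t - lams).
  split; apply: norm2_le_expR => //; first exact: divr_ge0 V0 (ltW Ki_gt0).
    rewrite mulrAC ler_pdivlMr// mulrC; apply: le_trans Vt.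
    by rewrite /V lerDl.
  by apply: le_trans Vt; rewrite /V lerDr.
have [K K0 bounded] := error_bounded f C d rho Ki Kp c_hi xs lams x lam f_smooth
  f_convex rho_gt0 Ki_gt0 Kp_gt0 chi0 CCT_hi zs_eq sol.
exists (Num.sqrt K + 1), (Num.sqrt K + 1).
split; try by rewrite ltr_wpDl ?sqrtr_ge0.
move=> t t0; have [Xt Lt] := bounded t t0.
have le_exp : K <= K * expR (- mu * t).
  by rewrite ler_peMr// -expR0 ler_expR mulr_ge0// oppr_ge0 ltW.
by split; apply: norm2_le_expR => //; exact: le_trans le_exp.
Qed.
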